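(* Let $G=\{g_k : k\geqslant 0\}$ be a countably infinite discrete abelian group, so that $(g_k)_{k\geqslant 0}$ is a sequence consisting of all elements of $G$. Then $(g_k)_{k\geqslant 0}$ is a $G$-Jamison sequence.
   Context: For a complex Banach space $X$, $\mathcal{GL}(X)$ denotes the group of invertible bounded linear operators on $X$. A representation of a topological abelian group $G$ is a couple $(X,\rho)$ where $X$ is a separable infinite-dimensional complex Banach space and $\rho:G\to\mathcal{GL}(X)$ is a continuous group homomorphism (continuity is automatic when $G$ is discrete). $\mathbb{T}$ is the unit circle of the complex plane. $\widehat{G}$ is the group of all continuous homomorphisms (characters) $\chi:G\to\mathbb{T}$; for $G$ discrete, these are all homomorphisms $G\to\mathbb{T}$. A character $\chi\in\widehat{G}$ is a unimodular eigenvalue of a representation $(X,\rho)$ of $G$ if there is $e_\chi\in X\setminus\{0\}$ such that $\rho(g)e_\chi=\chi(g)e_\chi$ for all $g\in G$. The set of unimodular eigenvalues is denoted by $\sigma_p(\rho)\cap\widehat{G}$. The representation is partially bounded with respect to a sequence $(g_k)_{k\geqslant 0}$ of elements of $G$ if $\sup_{k\geqslant 0}\|\rho(g_k)\|<+\infty$. A sequence $(g_k)_{k\geqslant 0}$ of elements of $G$ is a $G$-Jamison sequence if for every representation $(X,\rho)$ of $G$ which is partially bounded with respect to $(g_k)_{k\geqslant 0}$, the set $\sigma_p(\rho)\cap\widehat{G}$ is at most countable. *)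

(* Defs.v *)
From mathcomp Require Import all_boot all_order all_algebra.
From mathcomp Require Import all_classical all_reals all_analysis.
From mathcomp.real_closed Require Export complex.
Set Implicit Arguments.
Unset Strict Implicit.
Unset Printing Implicit Defensive.
Import Order.TTheory GRing.Theory Num.Theory.
Import numFieldNormedType.Exports.
Local Open Scope classical_set_scope.
Local Open Scope ring_scope.

Definition separable_space (T : topologicalType) : Prop :=
  exists A : set T, countable A /\ dense A.

Definition infinite_dimensional (K : fieldType) (X : lmodType K) : Prop :=
  ~ exists (n : nat) (e : 'I_n -> X),
      forall x : X, exists c : 'I_n -> K, x = \sum_(i < n) c i *: e i.

(* The norm of a complex normed module takes its (nonnegative real) values in
   [R[i]]; [complex.Re] brings them back to [R]. *)
Definition opnorm (R : realType) (X : normedModType R[i]) (T : X -> X) :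
    \bar R :=
  ereal_sup [set (complex.Re `|T x|)%:E | x in [set x : X | `|x| <= 1]].

Definition bounded_operator (R : realType) (X : normedModType R[i])
    (T : X -> X) : Prop :=
  linear T /\ (opnorm T < +oo)%E.

Definition GL (R : realType) (X : normedModType R[i]) : set (X -> X) :=
  [set T | bounded_operator T /\
    exists S : X -> X, [/\ bounded_operator S, cancel T S & cancel S T]].
Arguments GL {R} X _.

(* The group [G] is written additively.  Continuity is with respect to the
   operator-norm topology on [GL X]. *)
Record representation (R : realType) (G : topologicalZmodType)
    (X : completeNormedModType R[i]) (rho : G -> X -> X) : Prop := {
  rep_separable : separable_space X;
  rep_infinite_dimensional : infinite_dimensional X;
  rep_GL : forall g, GL X (rho g);
  rep_morph : forall g h, rho (g + h) = rho g \o rho h;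
  rep_continuous : forall (g : G) (eps : R), 0 < eps ->
    \forall h \near g, (opnorm (rho h \- rho g)%R < eps%:E)%E
}.

Record character (R : realType) (G : topologicalZmodType) (chi : G -> R[i]) :
    Prop := {
  char_unimodular : forall g, `|chi g| = 1;
  char_morph : forall g h, chi (g + h) = chi g * chi h;
  char_continuous : continuous (chi : G -> R[i]^o)
}.

Definition unimodular_eigenvalues (R : realType) (G : topologicalZmodType)
    (X : completeNormedModType R[i]) (rho : G -> X -> X) : set (G -> R[i]) :=
  [set chi | character chi /\
    exists e : X, e != 0 /\ forall g, rho g e = chi g *: e].

Definition partially_bounded (R : realType) (G : topologicalZmodType)
    (X : completeNormedModType R[i]) (rho : G -> X -> X) (g : nat -> G) :
    Prop :=
  (ereal_sup (range (fun k => opnorm (rho (g k)))) < +oo)%E.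

Definition Jamison_sequence (R : realType) (G : topologicalZmodType)
    (g : nat -> G) : Prop :=
  forall (X : completeNormedModType R[i]) (rho : G -> X -> X),
    representation rho -> partially_bounded rho g ->
    countable (unimodular_eigenvalues rho).

(* Main.v *)
Require Import Defs.
From mathcomp Require Import all_boot all_order all_algebra.
From mathcomp Require Import all_classical all_reals all_analysis.
From mathcomp Require Import lra.
Import Order.TTheory GRing.Theory Num.Theory.
Import numFieldNormedType.Exports.
Local Open Scope classical_set_scope.
Local Open Scope ring_scope.

(** Distinct characters of a group are uniformly far apart: if they stay within
    distance 1/2 of each other at every point, they coincide
    ([close_characters_eq]), because evaluating at [g + g] instead of [g]
    multiplies a small gap [|chi g - psi g|] by [|chi g + psi g| >= 3/2], so
    that a nonzero gap would grow beyond 1/2 under repeated doubling.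

    When the sequence exhausts the group, partial boundedness gives a single
    bound [M] for the norms of all the operators [rho h].  If [chi] and [psi]
    are eigenvalues with unit eigenvectors [e] and [f], then
    [(chi h - psi h) e = rho h (e - f) - psi h (e - f)], so the gap between
    the two characters is at most [(M + 1) |e - f|] ([eigenvalue_gap]).  Hence
    unit eigenvectors chosen for distinct eigenvalues are at distance at least
    [1 / (2 (M + 1))], and a separable space contains only countably many
    points that are uniformly separated ([countable_separated]). *)

(** The order of [R[i]] is partial, whereas the estimates below take place in
    the totally ordered field [R]. *)
Definition rnorm {R : rcfType} {V : normedZmodType R[i]} (x : V) : R :=
  complex.Re `|x|.

Lemma rnormE {R : rcfType} {V : normedZmodType R[i]} (x : V) :
  (rnorm x)%:C%C = `|x|.
Proof. by rewrite RRe_real// ger0_real. Qed.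

Lemma rnorm_ge0 {R : rcfType} {V : normedZmodType R[i]} (x : V) : 0 <= rnorm x.
Proof. by rewrite -ler0c rnormE. Qed.

Lemma rnorm_gt0 {R : rcfType} {V : normedZmodType R[i]} (x : V) :
  (0 < rnorm x) = (x != 0).
Proof. by rewrite -ltcR rnormE normr_gt0. Qed.

Lemma rnormN {R : rcfType} {V : normedZmodType R[i]} (x : V) :
  rnorm (- x) = rnorm x.
Proof. by rewrite /rnorm normrN. Qed.

Lemma ler_rnormD {R : rcfType} {V : normedZmodType R[i]} (x y : V) :
  rnorm (x + y) <= rnorm x + rnorm y.
Proof. by rewrite -lecR rmorphD /= !rnormE ler_normD. Qed.

Lemma ler_rnormB {R : rcfType} {V : normedZmodType R[i]} (x y : V) :
  rnorm (x - y) <= rnorm x + rnorm y.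
Proof. by rewrite -(rnormN y) ler_rnormD. Qed.

Lemma rnormM {R : rcfType} (x y : R[i]) : rnorm (x * y) = rnorm x * rnorm y.
Proof. by apply: complexI; rewrite rmorphM /= !rnormE normrM. Qed.

Lemma rnormZ {R : rcfType} {V : normedModType R[i]} (a : R[i]) (x : V) :
  rnorm (a *: x) = rnorm a * rnorm x.
Proof. by apply: complexI; rewrite rmorphM /= !rnormE normrZ. Qed.

Lemma rnorm_normalize {R : rcfType} {V : normedModType R[i]} (x : V) :
  x != 0 -> rnorm (`|x|^-1 *: x) = 1.
Proof.
move=> x0; apply: complexI.
by rewrite rnormE normrZ normfV normr_id mulVf// normr_eq0.
Qed.

Lemma opnorm_bound {R : realType} {X : normedModType R[i]} (T : X -> X)
    (M : R) (x : X) :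
  linear T -> (opnorm T <= M%:E)%E -> rnorm (T x) <= M * rnorm x.
Proof.
move=> linT TM; have [->|x0] := eqVneq x 0.
  have -> : T 0 = 0.
    by have /= := scalable_linear linT 0 0; rewrite !scale0r.
  by rewrite /rnorm normr0 mulr0.
have: rnorm (T (`|x|^-1 *: x)) <= M.
  rewrite -lee_fin; apply: le_trans TM; apply: ereal_sup_ubound.
  by exists (`|x|^-1 *: x) => //=; rewrite -rnormE rnorm_normalize.
rewrite (scalable_linear linT) /= rnormZ.
have := rnorm_normalize x x0; rewrite rnormZ => nx.
have xp : 0 < rnorm x by rewrite rnorm_gt0.
by move=> /(ler_wpM2r (ltW xp)); rewrite mulrAC nx mul1r.
Qed.

Lemma uniform_operator_bound {R : realType} {G : topologicalZmodType}
    {X : completeNormedModType R[i]} (rho : G -> X -> X) (g : nat -> G) :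
  (forall h, linear (rho h)) -> [set: G] = range g ->
  partially_bounded rho g ->
  exists2 M : R, 0 <= M & forall h x, rnorm (rho h x) <= M * rnorm x.
Proof.
move=> rhoL gT; rewrite /partially_bounded; set s := ereal_sup _ => sfin.
have [M sM] : exists M : R, (s <= M%:E)%E.
  by move: s sfin => [r| |] // _; [exists r | exists 0; rewrite leNye].
exists `|M| => // h x; apply: opnorm_bound; first exact: rhoL.
have [k _ <-] : range g h by rewrite -gT.
apply: (@le_trans _ _ s); first by apply: ereal_sup_ubound; exists k.
by apply: le_trans sM _; rewrite lee_fin ler_norm.
Qed.

Lemma eigenvalue_gap {R : realType} {X : normedModType R[i]} (T : X -> X)
    (M : R) (a b : R[i]) (e f : X) :
  linear T -> (forall x, rnorm (T x) <= M * rnorm x) ->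
  T e = a *: e -> T f = b *: f -> rnorm e = 1 -> rnorm b = 1 ->
  rnorm (a - b) <= (M + 1) * rnorm (e - f).
Proof.
move=> linT TM Te Tf e1 b1.
have -> : rnorm (a - b) = rnorm (T (e - f) - b *: (e - f)).
  rewrite (zmod_morphism_linear linT) Te Tf scalerBr opprB addrA.
  by rewrite subrK -scalerBl rnormZ e1 mulr1.
apply: le_trans (ler_rnormB _ _) _.
by rewrite rnormZ b1 mul1r mulrDl mul1r lerD2r TM.
Qed.

(** By induction on [n], the gap is at most [1 / (n + 2)] everywhere: apply the
    bound for [n] at [h + h], where the gap is at least 3/2 times the one at
    [h]. *)
Lemma close_characters_eq {R : realType} {G : nmodType} (chi psi : G -> R[i]) :
  (forall h, rnorm (psi h) = 1) ->
  {morph chi : g h / g + h >-> g * h} ->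
  {morph psi : g h / g + h >-> g * h} ->
  (forall h, rnorm (chi h - psi h) <= 1 / 2) -> chi = psi.
Proof.
move=> psi1 chiM psiM close.
have gap n h : (1 + n%:R / 2) * rnorm (chi h - psi h) <= 1 / 2.
  elim: n h => [|n IHn] h; first by rewrite mul0r addr0 mul1r.
  have := IHn (h + h); rewrite chiM psiM -!expr2 subr_sqr rnormM.
  have sum_ge : 3 / 2 <= rnorm (chi h + psi h).
    have := ler_rnormB (chi h + psi h) (chi h - psi h).
    have -> : chi h + psi h - (chi h - psi h) = 2%:R * psi h.
      by rewrite opprB addrC addrA subrK mulr_natl mulr2n.
    have -> : rnorm (2%:R * psi h) = 2.
      by rewrite rnormM psi1 mulr1 /rnorm normr_nat -(rmorph_nat (real_complex R)).
    by have := close h; move: (rnorm _) (rnorm _) => d s; lra.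
  rewrite -(natr1 n); set d := rnorm (chi h - psi h); set m : R := n%:R => IH.
  have d0 : 0 <= d by exact: rnorm_ge0.
  have md0 : 0 <= m * d by rewrite mulr_ge0.
  have : 0 <= (1 + m / 2) * d * (rnorm (chi h + psi h) - 3 / 2).
    by rewrite !mulr_ge0// ?subr_ge0// addr_ge0// divr_ge0.
  by lra.
apply/funext => h; apply/eqP; rewrite -subr_eq0; apply/negPn/negP.
rewrite -rnorm_gt0; set d := rnorm _ => d0.
have := archi_boundP (ltW (divr_gt0 (ltr01 : 0 < 1 :> R) d0)).
set n := Num.Def.archi_bound _.
rewrite ltr_pdivrMr// => nd; have := gap n h; rewrite -/d.
by nra.
Qed.

(** Approximating the family within [d / 2] by points of a countable dense set
    is an injective operation. *)
Lemma countable_separated {R : realType} {X : normedModType R[i]} {I : Type}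
    (S : set I) (v : I -> X) (d : R) :
  separable_space X -> 0 < d ->
  (forall i j, S i -> S j -> rnorm (v i - v j) < d -> i = j) -> countable S.
Proof.
move=> [A [cA dA]] d0 sep.
have approx i : exists a, A a /\ rnorm (v i - a) < d / 2.
  have r0 : 0 < (d / 2)%:C%C by rewrite ltcR divr_gt0.
  have [] := dA (ball (v i) (d / 2)%:C%C).
  - by exists (v i); exact: ballxx.
  - exact: ball_open.
  move=> a [via Aa]; exists a; split=> //.
  by move: via; rewrite -ball_normE /= -rnormE ltcR.
have [a aP] := choice approx.
have inj_a : {in S &, injective a}.
  move=> i j /set_mem Si /set_mem Sj aij; apply: sep => //.
  have -> : v i - v j = (v i - a i) - (v j - a j).
    by rewrite aij opprB addrA subrK.
  apply: le_lt_trans (ler_rnormB _ _) _.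
  by have [_ ai] := aP i; have [_ aj] := aP j; lra.
have aSA : (a @` S #<= A)%card.
  by apply: subset_card_le => _ [i _ <-]; exact: (aP i).1.
rewrite -(eq_countable (inj_card_eq inj_a)); exact: sub_countable aSA cA.
Qed.

Lemma unimodular_eigenvector {R : realType} {G : topologicalZmodType}
    {X : completeNormedModType R[i]} (rho : G -> X -> X) (chi : G -> R[i]) :
  (forall h, linear (rho h)) -> unimodular_eigenvalues rho chi ->
  exists e : X, rnorm e = 1 /\ forall h, rho h e = chi h *: e.
Proof.
move=> rhoL [_ [e [e0 eP]]]; exists (`|e|^-1 *: e).
split=> [|h]; first exact: rnorm_normalize.
by rewrite (scalable_linear (rhoL h)) /= eP !scalerA mulrC.
Qed.

Theorem corollary2p4 (R : realType) (G : topologicalZmodType) (g : nat -> G)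
    (hdiscrete : @nbhs G G = principal_filter)
    (hcountably_infinite : ([set: G] #= [set: nat])%card)
    (hg : [set: G] = range g) :
  Jamison_sequence R g.
Proof.
move=> X rho rep bnd.
have rhoL h : linear (rho h) by have [[]] := rep_GL rep h.
have [M M0 rhoM] := uniform_operator_bound rho g rhoL hg bnd.
have eigen chi : exists e : X, unimodular_eigenvalues rho chi ->
    rnorm e = 1 /\ forall h, rho h e = chi h *: e.
  have [chiE|nchiE] := pselect (unimodular_eigenvalues rho chi).
    by have [e eP] := unimodular_eigenvector rho chi rhoL chiE; exists e.
  by exists 0.
have [e eP] := choice eigen.
have M1 : 0 < 2 * (M + 1) by lra.
apply: (countable_separated _ e (2 * (M + 1))^-1 (rep_separable rep)).
  by rewrite invr_gt0.
move=> chi psi chiE psiE; rewrite -div1r ltr_pdivlMr// => near_e.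
have [[e1 echi] [_ epsi]] := (eP chi chiE, eP psi psiE).
have [[chiC _] [psiC _]] := (chiE, psiE).
have psi1 h : rnorm (psi h) = 1 by rewrite /rnorm (char_unimodular psiC).
apply: close_characters_eq => // [||h].
- exact: char_morph chiC.
- exact: char_morph psiC.
have := eigenvalue_gap _ _ _ _ _ _ (rhoL h) (rhoM h) (echi h) (epsi h) e1 (psi1 h).
by lra.
Qed.
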